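(* Let a sign pattern be given by a signed digraph on nodes $\{1,\dots,n\}$ with sign pattern matrix $\mathcal{A}$ (entries in $\{+,-,0\}$, entry $(j,l)$ nonzero meaning a directed edge $l\to j$ of the indicated sign) and input $B=b_1e_1$, $b_1>0$, such that node $1$ (the leader) has no incoming edges from the other nodes and every node is reachable from node $1$ by a directed walk. Consider temporally switching systems $\dot{x}(t)=A_ix(t)+Bu(t)$, $t\in[t_{i-1},t_i)$, in which every snapshot matrix $A_i$ has exactly the sign pattern $\mathcal{A}$ (same topology and same signs, only the magnitudes of the edge weights may differ between snapshots). Then there exist two realizations $A_1,A_2$ with sign pattern $\mathcal{A}$ and times $t_0<t_1<t_2$ such that the two-snapshot temporally switching system is completely herdable on $[t_0,t_2]$; that is, the temporal network with fixed topology is $\mathcal{SS}$ herdable within two snapshots (even when the static digraph is not $\mathcal{SS}$ herdable, e.g. because of signed or layer dilations).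
   Context: Completely herdable on $[t_0,t_f]$: for every initial condition $x(t_0)\in\mathbb{R}^n$ and every $h>0$ there is a piecewise continuous input $u$ on $[t_0,t_f]$ such that $x_j(t_f)\ge h$ for all $j=1,\dots,n$. A temporally switching digraph with a fixed sign pattern in all snapshots is $\mathcal{SS}$ herdable if there is a realization $(A_i,B)$ of the snapshots consistent with the sign pattern for which the temporal network is completely herdable. A signed dilation is a node whose outgoing edges have different signs; a layer dilation occurs in layer $L_k$ of the signed layered graph (layer $L_{k+1}$ = nodes reachable from the leader by a walk of length $k$) if the edges from nodes of $L_k$ to nodes of $L_{k+1}$ have mixed signs. *)

(* Defs.v *)
From HB Require Import structures.
From mathcomp Require Import all_boot all_order all_algebra.
From mathcomp Require Import all_classical all_reals all_analysis.
Set Implicit Arguments. Unset Strict Implicit. Unset Printing Implicit Defensive.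
Import Order.TTheory GRing.Theory Num.Theory.
Import numFieldNormedType.Exports.
Local Open Scope classical_set_scope.
Local Open Scope ring_scope.

(* A sign pattern on m nodes: an integer matrix with entries in {-1,0,1};
   entry (j,l) nonzero means a directed edge l -> j of the given sign. *)
Definition is_sign_pattern (m : nat) (P : 'M[int]_m) : Prop :=
  forall j l, P j l \in [:: (-1)%R; 0%R; 1%R].

Definition realizes (R : realType) (m : nat) (P : 'M[int]_m) (A : 'M[R]_m) : Prop :=
  forall j l, sgz (A j l) = P j l.

Definition pattern_edge (m : nat) (P : 'M[int]_m) : rel 'I_m :=
  fun l j => P j l != 0.

(* Piecewise continuity of a scalar input on [a,b]: a finite strictly
   increasing subdivision a = p_0 < ... < p_k = b such that on each open
   piece u coincides with a function continuous on the closed piece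
   (so that one-sided limits exist and are finite). *)
Definition piecewise_continuous (R : realType) (u : R -> R) (a b : R) : Prop :=
  exists s : seq R,
    let p := a :: rcons s b in
    sorted <%R p /\
    forall i, (i.+1 < size p)%N ->
      exists g : R -> R,
        {within [set` `[p`_i, p`_i.+1]], continuous g} /\
        forall t, p`_i < t < p`_i.+1 -> u t = g t.

Definition is_solution (R : realType) (m : nat) (Af : R -> 'M[R]_m)
    (B : 'cV[R]_m) (u : R -> R) (t0 tf : R) (x : 'I_m -> R -> R) : Prop :=
  (forall j, {within [set` `[t0, tf]], continuous (x j)}) /\
  exists S : seq R, forall t, t0 < t < tf -> t \notin S ->
    forall j, is_derive t 1 (x j) (\sum_l Af t j l * x l t + B j 0 * u t).

Definition completely_herdable (R : realType) (m : nat) (Af : R -> 'M[R]_m)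
    (B : 'cV[R]_m) (t0 tf : R) : Prop :=
  forall (x0 : 'I_m -> R) (h : R), 0 < h ->
    exists u : R -> R, piecewise_continuous u t0 tf /\
      exists x : 'I_m -> R -> R,
        is_solution Af B u t0 tf x /\ (forall j, x j t0 = x0 j) /\
        (forall j, h <= x j tf).

Definition two_snapshot (R : realType) (m : nat) (A1 A2 : 'M[R]_m) (t1 : R) :
    R -> 'M[R]_m :=
  fun t => if t < t1 then A1 else A2.

(* Main.v *)
Require Import Defs.
From HB Require Import structures.
From mathcomp Require Import all_boot all_order all_algebra.
From mathcomp Require Import all_classical all_reals all_analysis.
Set Implicit Arguments. Unset Strict Implicit. Unset Printing Implicit Defensive.
Import Order.TTheory GRing.Theory Num.Theory.
Import numFieldNormedType.Exports.
Local Open Scope classical_set_scope.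
Local Open Scope ring_scope.

(** From the zero state, the two-snapshot system reaches every vector of
    [e^(A2 (t2 - t1)) V1 + V2], where [Vi] is the span of the [Ai^k B]; by
    linearity it is herdable as soon as this space contains a positive vector.
    Positivity is an open condition, so one may take [t2 - t1] small, which
    leaves [V1 + V2], and also give small weights to all edges outside a
    spanning arborescence. For the arborescence alone [Ai^k e_0] is supported on
    the [k]-th layer, with forced signs but with magnitudes of our choice: give
    the first snapshot the layer vector [v], and the second one the vector with
    the positive entries of [v] doubled. The latter minus [3/2 v] is positive on
    the whole layer. *)

(** * Spanning arborescences and the powers of their matrices *)

Lemma spanning_arborescence (T : finType) (e : rel T) (r : T) :
  (forall j, connect e r j) ->
  exists (d : T -> nat) (p : T -> T),
    [/\ d r = 0%N, forall j, j != r -> d j = (d (p j)).+1 /\ e (p j) j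
      & forall j, (d j < #|T|)%N].
Proof.
move=> conn.
pose walk k j := [exists q : k.-tuple T, path e r q && (last r q == j)].
have walkP q j : path e r q -> last r q = j -> walk (size q) j.
  by move=> eq lq; apply/existsP; exists (in_tuple q); rewrite /= eq lq eqxx.
have short j : exists2 k, walk k j & (k < #|T|)%N.
  have /connectP[q eq ->] := conn j.
  case: (shortenP eq) => q' eq' uq' _.
  exists (size q'); first exact: walkP.
  by have := card_uniqP uq' => /= <-; exact: max_card.
have ex_walk j : exists k, walk k j by have [k wk _] := short j; exists k.
(* [d] is the distance from the root; the parent of [j] will be the last node but one on a shortest
   walk to [j]. *)
pose d j := ex_minn (ex_walk j).
have d_walk j : walk (d j) j by rewrite /d; case: ex_minnP.
have d_min k j : walk k j -> (d j <= k)%N by rewrite /d; case: ex_minnP => ? _; exact.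
have d0 : d r = 0%N by apply/eqP; rewrite -leqn0; exact: (d_min _ _ (walkP [::] r _ _)).
have parent j : exists i, j != r -> d j = (d i).+1 /\ e i j.
  have [->|jr] := eqVneq j r; first by exists r.
  have /existsP[[q /= /eqP sq] /andP[/=]] := d_walk j.
  case: (lastP q) sq => [/= _ _ /eqP rj|q' i sq]; first by rewrite rj eqxx in jr.
  rewrite rcons_path last_rcons size_rcons in sq * => /andP[eq' eqi] /eqP ij.
  rewrite ij in eqi; exists (last r q') => _; split => //.
  (* The prefix [q'] bounds the distance of the parent from above; a shortest walk to the parent,
     prolonged by the edge to [j], bounds it from below. *)
  apply/eqP; rewrite eqn_leq -{2}sq ltnS (d_min _ _ (walkP _ _ eq' erefl)) andbT.
  have /existsP[s /andP[es /eqP ls]] := d_walk (last r q').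
  have := @walkP (rcons s j) j; rewrite rcons_path es ls last_rcons size_rcons.
  by rewrite size_tuple => /(_ eqi erefl) /d_min.
have [p pP] : exists p : T -> T, forall j, j != r -> d j = (d (p j)).+1 /\ e (p j) j.
  have pb j : exists i, (j != r) ==> ((d j == (d i).+1) && e i j).
    have [i ip] := parent j; exists i; apply/implyP => /ip[-> ->].
    by rewrite eqxx.
  exists (fun j => xchoose (pb j)) => j jr.
  by have /implyP/(_ jr)/andP[/eqP] := xchooseP (pb j).
exists d, p; split => // j; have [k wk kT] := short j.
exact: leq_ltn_trans (d_min _ _ wk) kT.
Qed.

Section TreeMatrix.
Variables (R : idomainType) (n : nat) (d : 'I_n.+1 -> nat) (p : 'I_n.+1 -> 'I_n.+1).
Variable T : 'M[R]_n.+1.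
Hypotheses (d0 : d ord0 = 0%N) (dp : forall j, j != ord0 -> d j = (d (p j)).+1).
Hypothesis T0 : forall j l, (T j l != 0) = (j != ord0) && (l == p j).

(** Row [j] has its only nonzero entry at the parent and the root row vanishes, so the entry is the
    product of the weights met on climbing from [j] if the root is reached after exactly [k] steps,
    and 0 otherwise. *)
Lemma tree_mx_pow_neq0 k j : ((T ^+ k) j ord0 != 0) = (d j == k).
Proof.
elim: k j => [|k IH] j.
  rewrite expr0 mxE; have [->|jr] := eqVneq j ord0; first by rewrite d0 oner_eq0.
  by rewrite eqxx (dp jr).
rewrite exprS mxE; have [->|jr] := eqVneq j ord0.
  rewrite big1 ?eqxx ?d0 // => l _; have := T0 ord0 l; rewrite eqxx /=.
  by move/negbFE/eqP => ->; rewrite mul0r.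
rewrite (bigD1 (p j)) //= big1 => [|l lp]; last first.
  have := T0 j l; rewrite (negPf lp) andbF => /negbFE/eqP ->.
  by rewrite mul0r.
by rewrite addr0 mulf_eq0 negb_or T0 jr eqxx IH (dp jr) eqSS.
Qed.

End TreeMatrix.

Lemma exp_conj (R : unitRingType) (D A : R) k :
  D \is a GRing.unit -> (D * A / D) ^+ k = D * A ^+ k / D.
Proof.
move=> uD; elim: k => [|k IH]; first by rewrite !expr0 mulr1 mulrV.
by rewrite !exprS IH !mulrA mulrVK.
Qed.

(* Since T' = D T D^-1 with D = diag w, one has T'^k e_0 = D T^k e_0 / w_0. *)
Lemma tree_mx_positive (R : realFieldType) (n : nat) (d : 'I_n.+1 -> nat)
    (p : 'I_n.+1 -> 'I_n.+1) (T : 'M[R]_n.+1) :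
  d ord0 = 0%N -> (forall j, j != ord0 -> d j = (d (p j)).+1) ->
  (forall j, (d j < n.+1)%N) ->
  (forall j l, (T j l != 0) = (j != ord0) && (l == p j)) ->
  exists (w : 'I_n.+1 -> R) (c1 c2 : R),
    let T' := \matrix_(j, l) (w j * T j l / w l) in
    (forall j, 0 < w j) /\
    forall j, 0 < \sum_(k < n.+1)
      (c1 * (T ^+ k) j ord0 + c2 * (T' ^+ k) j ord0).
Proof.
move=> d0 dp dn T0.
pose w j : R := if 0 < (T ^+ d j) j ord0 then 2 else 1.
have w_gt0 j : 0 < w j by rewrite /w; case: ifP.
(* [c2 = w ord0] cancels the division by [w ord0]; the entry then gets the factor [w j - 3 / 2],
   which is 1/2 or -1/2 according to its sign. *)
exists w, (- 3 / 2), (w ord0) => T'; split => // j.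
pose D : 'M[R]_n.+1 := diag_mx (\row_l w l).
pose D' : 'M[R]_n.+1 := diag_mx (\row_l (w l)^-1).
have DD' : D *m D' = 1.
  rewrite mul_diag_mx; apply/matrixP => a b; rewrite !mxE.
  by case: eqVneq => [->|_]; rewrite ?mulr1n ?mulr0n ?mulr0 // divff // gt_eqF.
have uD : D \is a GRing.unit by apply/unitrP; exists D'; split => //; exact: mulmx1C.
have iD : D^-1 = D' by apply: (mulrI uD); rewrite mulrV.
have T'E : T' = D * T / D.
  rewrite iD /D /D'; apply/matrixP => a b.
  by rewrite -!mulmxE mul_mx_diag mul_diag_mx !mxE.
have powE k : (T' ^+ k) j ord0 = w j * (T ^+ k) j ord0 / w ord0.
  by rewrite T'E exp_conj // iD -!mulmxE mul_mx_diag mul_diag_mx !mxE.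
have Tj := tree_mx_pow_neq0 d0 dp T0.
(* Only the power [k = d j] contributes to row [j]. *)
rewrite (bigD1 (Ordinal (dn j))) //= big1 ?addr0 => [|k kd]; last first.
  have : (T ^+ k) j ord0 == 0.
    by apply: contraNT kd; rewrite Tj => /eqP dk; apply/eqP/val_inj.
  by rewrite powE => /eqP ->; rewrite !(mulr0, mul0r, addr0).
rewrite powE mulrCA divff ?gt_eqF // mulr1 -mulrDl.
have : (T ^+ d j) j ord0 != 0 by rewrite Tj.
rewrite /w; case: (ltgtP 0 ((T ^+ d j) j ord0)) => // t0 _; last first.
  by rewrite nmulr_lgt0 // mulNr addrC subr_lt0 ltr_pdivlMr // mul1r ltr_nat.
by rewrite mulr_gt0 // mulNr addrC subr_gt0 ltr_pdivrMr // -natrM ltr_nat.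
Qed.

(** * Flat outputs and polynomial steering *)

Section FlatTower.
Variables (R : numFieldType) (c : nat -> R).

(** When the state is expanded in the vectors A^k B and the coefficient [F] of A^n B is chosen
    freely, entry [i] is the coefficient of A^(n-i) B, and entry n+1 is the input. *)
Fixpoint flat_tower (F : {poly R}) (i : nat) : {poly R} :=
  if i is k.+1 then (flat_tower F k)^`() + c k *: F else F.

Lemma flat_towerD F G a i : flat_tower (F + a *: G) i = flat_tower F i + a *: flat_tower G i.
Proof.
elim: i => //= i ->; rewrite derivD derivZ !scalerDr !scalerA !addrA (mulrC (c i)).
by congr (_ + _); rewrite addrAC.
Qed.

(** Each derivative lowers the order of the zero at [a] by one and brings down the current exponent;
    the added multiple of the original polynomial still has a zero of order [N]. *)
Lemma flat_tower_root (a : R) N H k : (k <= N)%N ->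
  exists2 K, flat_tower (('X - a%:P) ^+ N * H) k = ('X - a%:P) ^+ (N - k) * K
           & K.[a] = (N ^_ k)%:R * H.[a].
Proof.
elim: k => [|k IH] kN; first by exists H; rewrite ?subn0 ?ffactn0 ?mul1r.
have [K fK Ka] := IH (ltnW kN); set Y := 'X - a%:P.
exists (K *+ (N - k) + Y * K^`() + c k *: (Y ^+ k.+1 * H)).
  have YN : Y ^+ N = Y ^+ (N - k.+1) * Y ^+ k.+1 by rewrite -exprD subnK.
  rewrite /= fK -/Y YN -(subnSK kN) derivM deriv_exp derivXsubC /= mul1r.
  rewrite !mulrDr; congr (_ + _ + _).
  - by rewrite subnSK // mulrnAl mulrnAr.
  - by rewrite exprS mulrA (mulrC Y).
  - by rewrite -mulrA scalerAr.
rewrite !(hornerE, hornerMn, horner_exp) /= subrr expr0n /= !(mul0r, mulr0, addr0).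
by rewrite Ka ffactnSr natrM mulrAC mulr_natr.
Qed.

(** Hermite interpolation by a triangular scheme: adding a multiple of (X-b)^i (X-a)^N leaves the
    prescribed values at [a] and the entries below [i] at [b] alone, while entry [i] at [b] changes
    by that multiple of i! (b-a)^N, which is nonzero. *)
Lemma flat_tower_interpolation (a b : R) N (v : nat -> R) : a != b ->
  exists F, forall k, (k < N)%N -> (flat_tower F k).[a] = 0 /\ (flat_tower F k).[b] = v k.
Proof.
move=> ab.
suff: forall i, (i <= N)%N -> exists F, (forall k, (k < N)%N -> (flat_tower F k).[a] = 0) /\
    forall k, (k < i)%N -> (flat_tower F k).[b] = v k.
  by move/(_ N (leqnn N)) => [F [F0 F1]]; exists F => k kN; split; [exact: F0|exact: F1].
elim=> [_|i IH iN].
  exists 0; split => // k _; suff -> : flat_tower 0 k = 0 by rewrite horner0.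
  by elim: k => //= k ->; rewrite deriv0 scaler0 addr0.
have [F [F0 F1]] := IH (ltnW iN).
pose G := ('X - b%:P) ^+ i * ('X - a%:P) ^+ N.
have Gb k : (k < i)%N -> (flat_tower G k).[b] = 0.
  move=> ki; have [K -> _] := flat_tower_root b (('X - a%:P) ^+ N) (ltnW ki).
  by rewrite hornerM horner_exp hornerXsubC subrr expr0n subn_eq0 leqNgt ki mul0r.
have Ga k : (k < N)%N -> (flat_tower G k).[a] = 0.
  move=> kN; rewrite /G mulrC; have [K -> _] := flat_tower_root a (('X - b%:P) ^+ i) (ltnW kN).
  by rewrite hornerM horner_exp hornerXsubC subrr expr0n subn_eq0 leqNgt kN mul0r.
have Gi : (flat_tower G i).[b] != 0.
  have [K -> Kb] := flat_tower_root b (('X - a%:P) ^+ N) (leqnn i).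
  rewrite subnn expr0 mul1r Kb ffactnn mulf_neq0 ?pnatr_eq0 -?lt0n ?fact_gt0 //.
  by rewrite horner_exp hornerXsubC expf_neq0 // subr_eq0 eq_sym.
exists (F + ((v i - (flat_tower F i).[b]) / (flat_tower G i).[b]) *: G); split=> k kN;
  rewrite flat_towerD hornerD hornerZ.
  by rewrite F0 // Ga // mulr0 addr0.
rewrite ltnS leq_eqVlt in kN; case/orP: kN => [/eqP ->|ki].
  by rewrite divfK // addrC subrK.
by rewrite F1 // (Gb k) // mulr0 addr0.
Qed.

End FlatTower.

(* Writing x = sum_k A^k B y_k, Cayley-Hamilton makes the equation
   x' = A x + B u equivalent to y_(k-1) = y_k' + c_k y_n and u = y_0' + c_0 y_n,
   with c_k the coefficients of the characteristic polynomial: y_n is free. *)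
Lemma polynomial_steering (R : numFieldType) (n : nat) (A : 'M[R]_n.+1)
    (B : 'cV[R]_n.+1) (v : nat -> R) (a b : R) : a != b ->
  exists (x : 'I_n.+1 -> {poly R}) (u : {poly R}), forall j,
    [/\ (x j)^`() = \sum_l A j l *: x l + B j 0 *: u, (x j).[a] = 0
      & (x j).[b] = \sum_(k < n.+1) v k * (A ^+ k *m B) j 0].
Proof.
move=> ab; pose q := char_poly A; pose c i := q`_(n - i).
(* The targets are reversed because tower entry [i] multiplies A^(n-i) B. *)
have [F FP] := flat_tower_interpolation c n.+1 (fun k => v (n - k)%N) ab.
pose x j := \sum_(k < n.+1) (A ^+ k *m B) j 0 *: flat_tower c F (n - k).
exists x, (flat_tower c F n.+1) => j; split; last 2 first.
- rewrite horner_sum big1 // => k _; rewrite hornerZ.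
  by have [-> _] := FP (n - k)%N (leq_subr _ _); rewrite mulr0.
- rewrite horner_sum; apply: eq_bigr => k _; rewrite hornerZ mulrC.
  by have [_ ->] := FP (n - k)%N (leq_subr _ _); rewrite subKn // -ltnS.
have CH : A ^+ n.+1 = - \sum_(k < n.+1) q`_k *: A ^+ k.
  have := Cayley_Hamilton A; rewrite -/q /horner_mx /= /horner_morph.
  have -> : map_poly scalar_mx q = \poly_(k < n.+2) (q`_k)%:M.
    by rewrite /map_poly size_char_poly.
  rewrite horner_poly big_ord_recr /=.
  have -> : q`_n.+1 = 1.
    by have := monicP (char_poly_monic A); rewrite lead_coefE size_char_poly.
  rewrite mul1r addrC => /eqP; rewrite addr_eq0 => /eqP ->; congr (- _).
  by apply: eq_bigr => k _; rewrite -mul_scalar_mx.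
have Ax : \sum_l A j l *: x l = \sum_(k < n.+1) (A ^+ k.+1 *m B) j 0 *: flat_tower c F (n - k).
  under eq_bigr do rewrite scaler_sumr; rewrite exchange_big /=.
  apply: eq_bigr => k _; rewrite exprS -mulmxA mxE scaler_suml.
  by apply: eq_bigr => l _; rewrite scalerA.
rewrite Ax [RHS]addrC.
have -> : (B j 0 *: flat_tower c F n.+1 +
    \sum_(k < n.+1) (A ^+ k.+1 *m B) j 0 *: flat_tower c F (n - k))
   = \sum_(k < n.+2) (A ^+ k *m B) j 0 *: flat_tower c F (n.+1 - k).
  rewrite [RHS]big_ord_recl expr0 mul1mx; congr (_ + _).
have CHj : (A ^+ n.+1 *m B) j 0 = - \sum_(k < n.+1) q`_k * (A ^+ k *m B) j 0.
  rewrite CH mulNmx mulmx_suml mxE summxE; congr (- _).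
  by apply: eq_bigr => k _; rewrite -scalemxAl mxE.
(* The top term carries [F] itself. Cayley-Hamilton spreads it over the lower powers, where it
   cancels the multiples of [F] added by the tower; only the derivatives remain. *)
rewrite big_ord_recr /= subnn CHj scaleNr scaler_suml -sumrB /x raddf_sum.
apply: eq_bigr => k _; rewrite [LHS]derivZ (subSn (leq_ord k)) [flat_tower _ _ _.+1]/=.
by rewrite /c (subKn (leq_ord k)) scalerDr scalerA [_ * q`_k]mulrC addrK.
Qed.

(** * The matrix exponential as a power series *)

Section LinearODE.
Variables (R : realType) (n : nat) (A : 'M[R]_n.+1).
Implicit Types (v : 'cV[R]_n.+1) (j : 'I_n.+1).

(** Taylor coefficients at 0 of component [j] of e^(tA) v. *)
Let coef v j (k : nat) : R := (A ^+ k *m v) j 0 / k`!%:R.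

Let coef_bound v : exists2 M : R, 0 <= M &
  exists2 C : R, 0 <= C & forall j k, `|(A ^+ k *m v) j 0| <= C * M ^+ k.
Proof.
pose M := \sum_i \sum_l `|A i l|; pose C := \sum_l `|v l 0|.
have M0 : 0 <= M by apply: sumr_ge0 => i _; exact: sumr_ge0.
have C0 : 0 <= C by exact: sumr_ge0.
exists M => //; exists C => // j k; elim: k j => [|k IH] j.
  rewrite !expr0 mul1mx mulr1 /C (bigD1 j) //= lerDl; exact: sumr_ge0.
rewrite exprS -mulmxA mxE (le_trans (ler_norm_sum _ _ _)) // exprS mulrCA.
have rowM : \sum_l `|A j l| <= M.
  by rewrite /M [leRHS](bigD1 j) //= lerDl; apply: sumr_ge0 => i _; exact: sumr_ge0.
apply: (@le_trans _ _ (\sum_l `|A j l| * (C * M ^+ k))).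
  by apply: ler_sum => l _; rewrite normrM ler_wpM2l.
by rewrite -mulr_suml ler_wpM2r // mulr_ge0 // exprn_ge0.
Qed.

Let cvg_coef v j (x : R) : cvgn (pseries (coef v j) x).
Proof.
have [M M0 [C C0 bnd]] := coef_bound v.
(* Comparison with the series of C e^(M|x|). *)
apply: normed_cvg; apply: (@series_le_cvg _ _ (C *: exp_coeff (M * `|x|))).
- by move=> k /=.
- by move=> k; rewrite /= mulr_ge0 // divr_ge0 // exprn_ge0 // mulr_ge0.
- move=> k; have -> : (C *: exp_coeff (M * `|x|)) k = C * ((M * `|x|) ^+ k / k`!%:R) by [].
  rewrite /= /coef normrM normrX normrM normfV.
  rewrite (ger0_norm (ler0n _ _)) exprMn [leRHS]mulrA mulrA mulrAC.
  by rewrite ler_wpM2r ?invr_ge0 // ler_wpM2r ?exprn_ge0.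
- by apply: is_cvg_seriesZ; exact: is_cvg_series_exp_coeff.
Qed.

Let diffs_coef v j : pseries_diffs (coef v j) = coef (A *m v) j.
Proof.
apply/funext => k; rewrite /pseries_diffs /coef exprSr -mulmxA factS natrM invfM.
by rewrite mulrCA; congr (_ * _); rewrite mulVKf.
Qed.

Lemma linear_ivp (a : R) (v : 'I_n.+1 -> R) : exists y : 'I_n.+1 -> R -> R,
  (forall j, y j a = v j) /\
  forall (t : R) j, is_derive t 1 (y j) (\sum_l A j l * y l t).
Proof.
pose w : 'cV[R]_n.+1 := \col_l v l.
exists (fun j t => limn (pseries (coef w j) (t - a))); split => [j|t j].
  apply: norm_lim_near_cst; near=> k; rewrite subrr /pseries /series /=.
  (* At 0 only the term of index 0 survives, so every nonempty partial sum equals the initial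
     value. *)
  have -> : k = k.-1.+1 by rewrite prednK //; near: k; exists 1%N.
  rewrite big_nat_recl // expr0 mulr1 /coef expr0 mul1mx mxE divr1.
  by rewrite big1 ?addr0 // => i _; rewrite expr0n mulr0.
have -> : \sum_l A j l * limn (pseries (coef w l) (t - a)) =
    limn (pseries (coef (A *m w) j) (t - a)).
  apply/esym/cvg_lim => //.
  have -> : pseries (coef (A *m w) j) (t - a) =
      fun k => \sum_l A j l * pseries (coef w l) (t - a) k.
    apply/funext => k; rewrite /pseries /series /=.
    under [RHS]eq_bigr do rewrite mulr_sumr.
    rewrite exchange_big /=; apply: eq_bigr => i _.
    have -> : coef (A *m w) j i = (A *m (A ^+ i *m w)) j 0 / i`!%:R.
      rewrite /coef !mulmxA; congr ((_ *m _) _ _ / _).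
      by rewrite !mulmxE -exprSr exprS.
    rewrite mxE !mulr_suml.
    by apply: eq_bigr => l _; rewrite !mulrA.
  apply: cvg_big => // [|l _]; first exact: add_continuous.
  by apply: cvgM; [exact: cvg_cst|exact: cvg_coef].
have dlim (x : R) : is_derive x 1 (fun x => limn (pseries (coef w j) x))
    (limn (pseries (coef (A *m w) j) x)).
  (* Termwise differentiation needs convergence of the series and of its first two derived series at
     a point beyond |x|; the derived series have the same form, with vectors A w and A^2 w. *)
  rewrite -diffs_coef; apply: (@pseries_snd_diffs _ _ (`|x| + 1)).
  - exact: cvg_coef.
  - by rewrite diffs_coef; exact: cvg_coef.
  - by rewrite !diffs_coef; exact: cvg_coef.
  - by rewrite [ltRHS]ger0_norm ?addr_ge0 // ltrDl.
have dsub : is_derive t 1 (fun s : R => s - a) 1.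
  by apply: is_derive_eq; rewrite subr0.
rewrite -[limn _]mulr1.
exact: (is_derive1_comp (f := fun x => limn (pseries (coef w j) x))).
Unshelve. all: by end_near.
Qed.

End LinearODE.

(** * Superposing and gluing trajectories *)

Definition trajectory (R : realType) (m : nat) (A : 'M[R]_m) (B : 'cV[R]_m)
    (u : R -> R) (x : 'I_m -> R -> R) : Prop :=
  forall (t : R) j, is_derive t 1 (x j) (\sum_l A j l * x l t + B j 0 * u t).

Section Trajectories.
Variables (R : realType) (m : nat).
Implicit Types (A : 'M[R]_m) (B : 'cV[R]_m) (u : R -> R) (x : 'I_m -> R -> R).

Lemma trajectoryD A B u1 u2 x1 x2 (c : R) :
  trajectory A B u1 x1 -> trajectory A B u2 x2 ->
  trajectory A B (fun t => u1 t + c * u2 t) (fun j t => x1 j t + c * x2 j t).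
Proof.
move=> d1 d2 t j; have d1t := d1 t j; have d2t := d2 t j.
have dd := is_deriveD d1t (is_deriveZ c d2t); apply: (is_derive_eq dd).
rewrite [c *: _]mulrDr mulr_sumr addrACA mulrCA -mulrDr -big_split /=; congr (_ + _).
by apply: eq_bigr => l _; rewrite mulrDr (mulrCA c).
Qed.

Lemma trajectory_continuous A B u x j : trajectory A B u x -> continuous (x j).
Proof.
move=> d t; apply/differentiable_continuous/derivable1_diffP.
by have dxt := d t j; exact: ex_derive.
Qed.

Lemma two_snapshot_solution A1 A2 B u1 u2 x1 x2 (t0 t1 t2 : R) :
  trajectory A1 B u1 x1 -> trajectory A2 B u2 x2 -> (forall j, x1 j t1 = x2 j t1) ->
  is_solution (two_snapshot A1 A2 t1) B (fun t => if t < t1 then u1 t else u2 t)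
    t0 t2 (fun j t => if t < t1 then x1 j t else x2 j t).
Proof.
move=> d1 d2 x12; split => [j|].
  apply: continuous_subspaceT.
  (* Freezing each piece beyond [t1] by [min] and [max] turns the glued function into a combination
     of continuous functions. *)
  have -> : (fun t => if t < t1 then x1 j t else x2 j t) =
      (fun t => x1 j (Num.min t t1) + x2 j (Num.max t t1) - x1 j t1).
    apply/funext => t; case: ltP => _; first by rewrite -x12 addrK.
    by rewrite addrAC subrr add0r.
  move=> t; apply: cvgB; last exact: cvg_cst.
  apply: cvgD.
    apply: (continuous_comp (f := fun t => Num.min t t1) (g := x1 j)).
      by apply: continuous_min; [exact: cvg_id|exact: cvg_cst].
    exact: trajectory_continuous d1 _.
  apply: (continuous_comp (f := fun t => Num.max t t1) (g := x2 j)).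
    by apply: continuous_max; [exact: cvg_id|exact: cvg_cst].
  exact: trajectory_continuous d2 _.
(* Away from the switching time the glued function agrees locally with one of the two pieces. *)
exists [:: t1] => t _; rewrite inE => tt1 j.
rewrite /two_snapshot; case: (ltP t t1) => t1t.
  apply: (near_eq_is_derive (f := x1 j)); last exact: d1.
  near=> s; rewrite ifT //; near: s; exact: lt_nbhsl.
have {tt1}t1t : t1 < t by rewrite lt_neqAle eq_sym tt1.
apply: (near_eq_is_derive (f := x2 j)); last exact: d2.
near=> s; rewrite ifF //; apply/negbTE; rewrite -leNgt ltW //; near: s; exact: lt_nbhsr.
Unshelve. all: by end_near.
Qed.

Lemma piecewise_continuous_glue u1 u2 (t0 t1 t2 : R) : t0 < t1 -> t1 < t2 ->
  continuous u1 -> continuous u2 ->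
  piecewise_continuous (fun t => if t < t1 then u1 t else u2 t) t0 t2.
Proof.
move=> t01 t12 c1 c2; exists [:: t1] => /=; split; first by rewrite t01 t12.
case=> [|[|//]] _ /=.
  exists u1; split; first exact: continuous_subspaceT.
  by move=> t /andP[_ ->].
exists u2; split; first exact: continuous_subspaceT.
by move=> t /andP[/ltW]; rewrite leNgt => /negPf ->.
Qed.

End Trajectories.

(** * From a positive response to herdability *)

Section Herding.
Variables (R : realType) (n : nat).
Implicit Types (A : 'M[R]_n.+1) (B : 'cV[R]_n.+1).

Lemma free_trajectory A B (a : R) (v : 'I_n.+1 -> R) :
  exists2 x, trajectory A B (cst 0) x & forall j, x j a = v j.
Proof.
have [y [ya dy]] := linear_ivp A a v; exists y => // t j.
by rewrite mulr0 addr0.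
Qed.

Lemma steering_trajectory A B (v : nat -> R) (a b : R) : a < b ->
  exists u, continuous u /\ exists2 x, trajectory A B u x & forall j,
    x j a = 0 /\ x j b = \sum_(k < n.+1) v k * (A ^+ k *m B) j 0.
Proof.
move=> /lt_eqF/negbT ab; have [x [u xu]] := polynomial_steering A B v ab.
exists (horner u); split; first exact: continuous_horner.
exists (fun j => horner (x j)) => [t j|j]; last by have [] := xu j.
have [dx _ _] := xu j; have := is_derive_poly (x j) t.
rewrite dx hornerD hornerZ horner_sum.
by under eq_bigr do rewrite hornerZ.
Qed.

(** By linearity, a large multiple of the positive response from rest outweighs the free motion
    issued from any initial state. *)
Lemma herdable_of_positive_response A1 A2 B u1 u2 x1 x2 (t0 t1 t2 : R) :
  t0 < t1 -> t1 < t2 -> continuous u1 -> continuous u2 ->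
  trajectory A1 B u1 x1 -> trajectory A2 B u2 x2 ->
  (forall j, x1 j t0 = 0) -> (forall j, x1 j t1 = x2 j t1) ->
  (forall j, 0 < x2 j t2) ->
  completely_herdable (two_snapshot A1 A2 t1) B t0 t2.
Proof.
move=> t01 t12 c1 c2 d1 d2 x10 x12 x2_gt0 x0 h h0.
have [y1 dy1 y10] := free_trajectory A1 B t0 x0.
have [y2 dy2 y21] := free_trajectory A2 B t1 (fun j => y1 j t1).
(* A sum of nonnegative ratios, hence at least the ratio that each single node requires. *)
pose lam := \sum_j `|h - y2 j t2| / x2 j t2.
exists (fun t => if t < t1 then cst 0 t + lam * u1 t else cst 0 t + lam * u2 t); split.
  by apply: piecewise_continuous_glue => // t; apply: cvgD;
    [exact: cvg_cst|apply: cvgM; [exact: cvg_cst|exact: c1]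
    |exact: cvg_cst|apply: cvgM; [exact: cvg_cst|exact: c2]].
exists (fun j t => if t < t1 then y1 j t + lam * x1 j t else y2 j t + lam * x2 j t).
split; last split => j.
- apply: two_snapshot_solution; [exact: trajectoryD|exact: trajectoryD|].
  by move=> j; rewrite y21 x12.
- by rewrite t01 y10 x10 mulr0 addr0.
- rewrite ltNge (ltW t12) /= -lerBlDl.
  apply: le_trans (ler_norm _) _; rewrite -ler_pdivrMr //.
  rewrite /lam [leRHS](bigD1 j) //= lerDl; apply: sumr_ge0 => i _.
  by rewrite divr_ge0 // ltW.
Qed.

(* For t2 close to t1 the free flow of A2 barely moves the state v1 reached at t1. *)
Lemma herdable_of_positive_sum A1 A2 B (v1 v2 : nat -> R) :
  (forall j, 0 < \sum_(k < n.+1) v1 k * (A1 ^+ k *m B) j 0 +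
                 \sum_(k < n.+1) v2 k * (A2 ^+ k *m B) j 0) ->
  exists t0 t1 t2 : R, [/\ t0 < t1, t1 < t2
    & completely_herdable (two_snapshot A1 A2 t1) B t0 t2].
Proof.
set w1 := fun j => \sum_(k < n.+1) v1 k * (A1 ^+ k *m B) j 0.
set w2 := fun j => \sum_(k < n.+1) v2 k * (A2 ^+ k *m B) j 0.
move=> w_gt0.
have [u1 [c1 [x1 d1 x1E]]] := steering_trajectory A1 B v1 (@ltr01 R).
have [y dy y1] := free_trajectory A2 B 1 w1.
have [t2 [t12 yw]] : exists t2 : R, 1 < t2 /\ forall j, 0 < y j t2 + w2 j.
  have ev : \forall t \near (1 : R)^'+, forall j, 0 < y j t + w2 j.
    apply: filter_forall => j; apply: cvgr_gt (w_gt0 j).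
    rewrite -[X in X + _](y1 j); apply: cvgD; last exact: cvg_cst.
    by apply: cvg_at_right_filter; exact: trajectory_continuous dy _.
  near (1 : R)^'+ => t; exists t; split; last by near: t.
  by near: t; exact: nbhs_right_gt.
(* This steers rest to [w2] under the second snapshot; superposed on the free flow [y], it ends at
   the positive state [y j t2 + w2 j]. *)
have [u2 [c2 [x2 d2 x2E]]] := steering_trajectory A2 B v2 t12.
exists 0, 1, t2; split => //.
apply: (@herdable_of_positive_response _ _ _ u1 (fun t => cst 0 t + 1 * u2 t)
  x1 (fun j t => y j t + 1 * x2 j t)) => //.
- move=> t; apply: cvgD; first exact: cvg_cst.
  by apply: cvgM; [exact: cvg_cst|exact: c2].
- exact: trajectoryD.
- by move=> j; have [] := x1E j.
- by move=> j; have [_ ->] := x1E j; have [-> _] := x2E j; rewrite y1 mulr0 addr0.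
- by move=> j; have [_ ->] := x2E j; rewrite mul1r.
Unshelve. all: by end_near.
Qed.

End Herding.

(** * Perturbing the arborescence to the full sign pattern *)

Lemma continuous_pow_perturbation (R : realType) (n : nat) (A Q : 'M[R]_n.+1) k j l :
  continuous (fun e : R => ((A + e *: Q) ^+ k) j l).
Proof.
elim: k j => [|k IH] j e; first by under eq_fun do rewrite expr0; exact: cvg_cst.
have -> : (fun e : R => ((A + e *: Q) ^+ k.+1) j l) =
    fun e => \sum_i (A j i + e * Q j i) * ((A + e *: Q) ^+ k) i l.
  apply/funext => s; rewrite exprS mxE; apply: eq_bigr => i _.
  by rewrite !mxE.
apply: cvg_big => [|i _]; first exact: add_continuous.
apply: cvgM; last exact: IH.
apply: cvgD; first exact: cvg_cst.
by apply: cvgM; [exact: cvg_id|exact: cvg_cst].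
Qed.

(* Nodes are 'I_n.+1; the leader (node 1 of the paper) is ord0. *)
Theorem mainTheorem4 (R : realType) (n : nat) (P : 'M[int]_n.+1) (b1 : R) :
  is_sign_pattern P ->
  0 < b1 ->
  (forall l : 'I_n.+1, l != ord0 -> P ord0 l = 0) ->
  (forall j : 'I_n.+1, connect (pattern_edge P) ord0 j) ->
  exists (A1 A2 : 'M[R]_n.+1) (t0 t1 t2 : R),
    realizes P A1 /\ realizes P A2 /\ t0 < t1 /\ t1 < t2 /\
    completely_herdable (two_snapshot A1 A2 t1)
      (b1 *: delta_mx ord0 ord0) t0 t2.
Proof.
move=> signP b1_gt0 _ reach.
have [d [p [d0 dp dn]]] := spanning_arborescence reach.
(* [Q] is the realization with unit weights, and [T] keeps only its arborescence edges. *)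
pose Q : 'M[R]_n.+1 := \matrix_(j, l) (P j l)%:~R.
pose T : 'M[R]_n.+1 := \matrix_(j, l) if (j != ord0) && (l == p j) then Q j l else 0.
have T0 j l : (T j l != 0) = (j != ord0) && (l == p j).
  rewrite !mxE; case: ifP; rewrite ?eqxx // => /andP[/dp[_ ej] /eqP ->].
  by rewrite intr_eq0.
have dn' j : (d j < n.+1)%N by rewrite -[X in (_ < X)%N]card_ord.
have [w [c1 [c2 [w_gt0 pos]]]] :=
  tree_mx_positive d0 (fun j jr => (dp j jr).1) dn' T0.
set T' := \matrix_(j, l) _ in pos.
have sgzQ j l (a : R) : 0 < a -> sgz (a * Q j l) = P j l.
  move=> a0; rewrite sgzM gtr0_sgz // mul1r mxE.
  by have := signP j l; rewrite !inE => /or3P[] /eqP ->;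
    rewrite ?mulrN1z ?mulr1z ?mulr0z ?sgzN ?sgz1 ?sgz0.
(* A nonnegative multiple of each entry of [Q], increased by [e], becomes a positive one, so the
   missing edges appear with their prescribed signs. *)
have realT (S : 'M[R]_n.+1) e : 0 < e ->
    (forall j l, exists2 a, 0 <= a & S j l = a * Q j l) -> realizes P (S + e *: Q).
  move=> e0 SP j l; rewrite mxE [(e *: Q) j l]mxE; have [a a0 ->] := SP j l.
  by rewrite -mulrDl sgzQ // ltr_wpDl.
have TP j l : exists2 a, 0 <= a & T j l = a * Q j l.
  rewrite mxE; case: ifP => _; first by exists 1; rewrite ?mul1r.
  by exists 0; rewrite ?mul0r.
have T'P j l : exists2 a, 0 <= a & T' j l = a * Q j l.
  have [a a0 Ta] := TP j l; exists (w j * a / w l); last by rewrite mxE Ta mulrA mulrAC.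
  by rewrite divr_ge0 ?mulr_ge0 // ltW.
(* The strict inequalities hold at [e = 0], so by continuity they persist for small positive [e]. *)
have [e [e0 pe]] : exists e : R, 0 < e /\ forall j, 0 < \sum_(k < n.+1)
    (c1 * ((T + e *: Q) ^+ k) j ord0 + c2 * ((T' + e *: Q) ^+ k) j ord0).
  have ev : \forall e \near (0 : R)^'+, forall j, 0 < \sum_(k < n.+1)
      (c1 * ((T + e *: Q) ^+ k) j ord0 + c2 * ((T' + e *: Q) ^+ k) j ord0).
    apply: filter_forall => j; apply: cvgr_gt (pos j); apply: cvg_at_right_filter.
    apply: cvg_big => [|k _]; first exact: add_continuous.
    apply: cvgD; apply: cvgM; try exact: cvg_cst.
      by have := @continuous_pow_perturbation R n T Q k j ord0 0;
        rewrite /continuous_at scale0r addr0.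
    by have := @continuous_pow_perturbation R n T' Q k j ord0 0;
        rewrite /continuous_at scale0r addr0.
  near (0 : R)^'+ => e; exists e; split; last by near: e.
  by near: e; exact: nbhs_right_gt.
have powB (A : 'M[R]_n.+1) k j :
    (A ^+ k *m (b1 *: delta_mx ord0 ord0 : 'cV_n.+1)) j 0 = b1 * (A ^+ k) j ord0.
  by rewrite -scalemxAr -colE !mxE.
have [|t0 [t1 [t2 [t01 t12 herd]]]] := @herdable_of_positive_sum R n (T + e *: Q)
    (T' + e *: Q) (b1 *: delta_mx ord0 ord0) (fun=> c1) (fun=> c2).
  move=> j; have := mulr_gt0 b1_gt0 (pe j).
  rewrite -big_split mulr_sumr /=; congr (0 < _); apply: eq_bigr => k _.
  by rewrite !powB mulrDr !(mulrCA b1).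
exists (T + e *: Q), (T' + e *: Q), t0, t1, t2.
by do !split => //; exact: realT.
Unshelve. all: by end_near.
Qed.
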